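(* Let $n = 2^k m$, where $m$ is an odd squarefree positive integer and $k\ge 0$ is an integer. If $n\ge 841$, then $$\frac{\sigma(n)}{n\log\log n} < e^\gamma.$$
   Context: $\sigma(n)$ denotes the sum of the positive divisors of $n$, $\gamma$ is the Euler–Mascheroni constant, and $\log$ is the natural logarithm. *)

(* Defs.v *)
From Stdlib Require Import Reals Lra.
From Coquelicot Require Import Coquelicot.
From mathcomp Require Import all_boot.

Set Implicit Arguments.
Unset Strict Implicit.
Unset Printing Implicit Defensive.

Definition sum_divisors (n : nat) : nat := (\sum_(d <- divisors n) d)%N.

Definition squarefree (m : nat) : Prop :=
  forall d : nat, (d ^ 2 %| m)%N -> d = 1%N.

Local Open Scope R_scope.

Definition harmonic_sub_ln (n : nat) : R :=
  sum_n_m (fun k => / INR k) 1 n - ln (INR n).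

(* [Lim_seq] is total; [is_lim_euler_gamma] shows that the limit exists. *)
Definition euler_gamma : R := real (Lim_seq harmonic_sub_ln).

Lemma ln_sub_le (a b : R) : 0 < a -> 0 < b -> ln a - ln b <= (a - b) / b.
Proof.
move=> a_gt0 b_gt0; rewrite -ln_div //.
have := exp_ineq1_le (ln (a / b)).
rewrite exp_ln; last exact: Rdiv_lt_0_compat.
have -> : (a - b) / b = a / b - 1 by field; lra.
lra.
Qed.

Lemma harmonic_sub_ln_decr (n : nat) :
  harmonic_sub_ln n.+2 <= harmonic_sub_ln n.+1.
Proof.
rewrite /harmonic_sub_ln sum_n_Sm; last exact/leP.
rewrite /plus -/(INR n.+1) [X in X <= _]/= -/(INR n.+1) -/(INR n.+2).
have n1_gt0 : 0 < INR n.+1 by rewrite S_INR; have := pos_INR n; lra.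
have n2E : INR n.+2 = INR n.+1 + 1 by rewrite S_INR.
have n2_gt0 : 0 < INR n.+2 by lra.
have := ln_sub_le n1_gt0 n2_gt0.
have -> : (INR n.+1 - INR n.+2) / INR n.+2 = - / INR n.+2.
  by rewrite n2E; field; lra.
move: n1_gt0 n2E n2_gt0 (sum_n_m _ _ _).
move: (INR n.+1) (INR n.+2) => x y *; rewrite /AbelianMonoid.sort /=; lra.
Qed.

Lemma ln_le_harmonic (n : nat) :
  ln (INR n.+1) <= sum_n_m (fun k => / INR k) 1 n.
Proof.
elim: n => [|n IHn].
  by rewrite sum_n_m_zero; [rewrite ln_1; apply: Rle_refl | apply/leP].
rewrite sum_n_Sm; last exact/leP.
have n1_gt0 : 0 < INR n.+1 by rewrite S_INR; have := pos_INR n; lra.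
have n2E : INR n.+2 = INR n.+1 + 1 by rewrite S_INR.
have n2_gt0 : 0 < INR n.+2 by lra.
have := ln_sub_le n2_gt0 n1_gt0.
have -> : (INR n.+2 - INR n.+1) / INR n.+1 = / INR n.+1.
  by rewrite n2E; field; lra.
by rewrite /plus; move: IHn => /=; lra.
Qed.

Lemma is_lim_euler_gamma : is_lim_seq harmonic_sub_ln euler_gamma.
Proof.
apply: Lim_seq_correct'.
suff [l Hl] : ex_finite_lim_seq (fun n => harmonic_sub_ln n.+1).
  by exists l; apply/is_lim_seq_incr_1.
apply: (ex_finite_lim_seq_decr _ 0) => n; first exact: harmonic_sub_ln_decr.
have n1_gt0 : 0 < INR n.+1 by rewrite S_INR; have := pos_INR n; lra.
have n2E : INR n.+2 = INR n.+1 + 1 by rewrite S_INR.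
have := ln_le_harmonic n.+1.
have : ln (INR n.+1) <= ln (INR n.+2) by apply: Rcomplements.ln_le; lra.
rewrite /harmonic_sub_ln; lra.
Qed.

(* Main.v *)
(* For an odd squarefree m with set of primes A, sigma(n)/n is at most
   (2 - 2^-k) prod_(p in A) (1 + 1/p). Passing from A to all the odd primes up to a cutoff y,
   this is about 2 prod_(3 <= p <= y) (1 + 1/p), asymptotic to (8/pi^2) e^gamma ln y with
   y ~ ln n. The factor 8/pi^2 < 1 leaves a margin of 19%, so crude explicit versions of the
   theorems of Chebyshev (theta n <= n ln 4) and Mertens suffice once ln m >= 2^15, starting
   from the numerical value of the product at 2^15. Below that, the product over the odd
   primes up to some y_(i+1) is compared with ln ln of the product of the odd primes up to
   y_i along a short sequence of cutoffs y_i; at most six odd primes need a discussion of k. *)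
Require Import Defs.
From HB Require Import structures.
From Stdlib Require Import Reals Lra ZArith.
From Coquelicot Require Import Coquelicot.
From mathcomp Require Import all_boot zify.

Set Implicit Arguments.
Unset Strict Implicit.
Unset Printing Implicit Defensive.

Local Open Scope R_scope.

(** * Explicit bounds on logarithms and on Euler's constant *)

(** Among sets A of r odd primes, the first r odd primes maximise the sum of ln (1 + 1/p) and at the
    same time minimise the sum of ln p. In the finite range the cardinality of A is therefore the
    only parameter. The cutoff 2^15 is dictated by the crude Mertens bound. It allows E(y) = sum (ln
    p)/p - ln y to rise to -0.586, while the certified value at 2^15 is about -1.70. This loss of
    about 1.12, together with a loss of about 1 for the primes of A beyond y, is divided by ln 2^15
    and costs a factor 1.2285. The final comparison is then 1.775 against 1.78, the rational lower
    bound used for e^gamma. A power of two makes the logarithm of the cutoff an explicit multiple of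
    ln 2. At the other end, bounding 2 - 2^-k by 2 and ln n below by ln m fails for the six primes
    3, ..., 17: twice the product is about 4.55, against 1.78 ln ln m of about 4.48. There a small k
    must be used through 2 - 2^-k, and a large one through the term k ln 2 of ln n. *)

Lemma INR_gt0 (n : nat) : (0 < n)%N -> 0 < INR n.
Proof. by move=> /ltP /lt_0_INR. Qed.

Lemma INR_leq (a b : nat) : (a <= b)%N -> INR a <= INR b.
Proof. by move=> /leP /le_INR. Qed.

Lemma INR_expn (a j : nat) : INR (a ^ j) = INR a ^ j.
Proof. by elim: j => [|j IHj] //; rewrite expnS mult_INR IHj. Qed.

(** Midpoint rule for the convex function 1/x on [1 - t, 1 + t]. *)
Lemma ln_ge1_midpoint (t : R) : 0 <= t < 1 -> 2 * t <= ln ((1 + t) / (1 - t)).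
Proof.
move=> t01.
have [t0|tneq0] := Req_dec t 0.
  by rewrite t0 (_ : (1 + 0) / (1 - 0) = 1); [rewrite ln_1; lra | field].
rewrite ln_div; [|lra|lra].
have [||c [c_in /=]] := @MVT_gen (fun x => ln (1 + x) - ln (1 - x) - 2 * x) 0 t
   (fun x => / (1 + x) + / (1 - x) - 2).
- move=> x; rewrite Rmin_left ?Rmax_right; try lra; move=> x_in.
  by auto_derive; [lra | field; lra].
- move=> x; rewrite Rmin_left ?Rmax_right; try lra; move=> x_in.
  apply/derivable_continuous_pt/ex_derive_Reals_0.
  by auto_derive; lra.
move: c_in; rewrite Rmin_left ?Rmax_right; try lra; move=> c_in.
have -> : / (1 + c) + / (1 - c) - 2 = 2 * c ^ 2 / ((1 + c) * (1 - c)).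
  by field; lra.
have ? : 0 <= 2 * c ^ 2 / ((1 + c) * (1 - c)) * (t - 0).
  apply: Rmult_le_pos; last lra.
  by apply: Rdiv_le_0_compat; [have := pow2_ge_0 c; lra | nra].
rewrite Rplus_0_r Rminus_0_r ln_1; lra.
Qed.

(** Trapezoid rule for the convex function 1/x on [1, 1 + t]. *)
Lemma ln_le_trapezoid (t : R) : 0 <= t -> ln (1 + t) <= t * (2 + t) / (2 * (1 + t)).
Proof.
move=> t_ge0.
have [t0|tneq0] := Req_dec t 0.
  by rewrite t0 Rplus_0_r ln_1; lra.
have [||c [c_in /=]] := @MVT_gen (fun x => x * (2 + x) / (2 * (1 + x)) - ln (1 + x)) 0 t
   (fun x => x ^ 2 / (2 * (1 + x) ^ 2)).
- move=> x; rewrite Rmin_left ?Rmax_right; try lra; move=> x_in.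
  by auto_derive; [lra | field; lra].
- move=> x; rewrite Rmin_left ?Rmax_right; try lra; move=> x_in.
  apply/derivable_continuous_pt/ex_derive_Reals_0.
  by auto_derive; lra.
move: c_in; rewrite Rmin_left ?Rmax_right; try lra; move=> c_in.
have /= ? : 0 <= c ^ 2 / (2 * (1 + c) ^ 2) * (t - 0).
  apply: Rmult_le_pos; last lra.
  apply: Rdiv_le_0_compat; first by have := pow2_ge_0 c; lra.
  by have := @pow_lt (1 + c) 2 ltac:(lra); lra.
rewrite (Rplus_0_r 1) ln_1; lra.
Qed.

Lemma ln2_upper : ln 2 <= 69316 / 100000.
Proof.
rewrite -[X in _ <= X]ln_exp; apply: Rcomplements.ln_le; first lra.
by have := @exp_ge_taylor (69316 / 100000) 7 ltac:(lra); rewrite /=; lra.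
Qed.

(** The midpoint rule is applied on the sixteen unit intervals of [16, 32]. *)
Lemma ln2_lower : 6930 / 10000 <= ln 2.
Proof.
have step (a b : R) : 0 < a < b -> 2 * ((b - a) / (b + a)) <= ln b - ln a.
  move=> ab; rewrite -ln_div; [|lra|lra].
  have -> : b / a = (1 + (b - a) / (b + a)) / (1 - (b - a) / (b + a)).
    by field; lra.
  apply: ln_ge1_midpoint; split; first by apply: Rdiv_le_0_compat; lra.
  by apply: (Rmult_lt_reg_r (b + a)); [lra | field_simplify; lra].
have := (step 16 17 ltac:(lra), step 17 18 ltac:(lra), step 18 19 ltac:(lra),
  step 19 20 ltac:(lra)).
move=> [[[]]]; have := (step 20 21 ltac:(lra), step 21 22 ltac:(lra),
  step 22 23 ltac:(lra), step 23 24 ltac:(lra)).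
move=> [[[]]]; have := (step 24 25 ltac:(lra), step 25 26 ltac:(lra),
  step 26 27 ltac:(lra), step 27 28 ltac:(lra)).
move=> [[[]]]; have := (step 28 29 ltac:(lra), step 29 30 ltac:(lra),
  step 30 31 ltac:(lra), step 31 32 ltac:(lra)).
move=> [[[]]].
have -> : 32 = 16 * 2 by lra.
rewrite ln_mult; [lra|lra|lra].
Qed.

(** With i/j a lower approximation of the binary logarithm of a/b, a bound on a logarithm becomes a
    comparison of integers decided by computation. *)
Lemma ln_lower (a b : Z) (i j : nat) : (0 < a)%Z -> (0 < b)%Z -> (0 < j)%N ->
  (2 ^ Z.of_nat i * b ^ Z.of_nat j <=? a ^ Z.of_nat j)%Z = true ->
  INR i / INR j * ln 2 <= ln (IZR a / IZR b).
Proof.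
move=> /IZR_lt a0 /IZR_lt b0 /INR_gt0 j0 /Z.leb_le /IZR_le.
rewrite mult_IZR -!pow_IZR => h.
have {}h : 2 ^ i <= (IZR a / IZR b) ^ j.
  rewrite Rpow_mult_distr pow_inv; apply: (Rmult_le_reg_r (IZR b ^ j)).
    exact: pow_lt.
  rewrite Rmult_assoc Rinv_l ?Rmult_1_r //.
  by apply: pow_nonzero; lra.
have ab0 : 0 < IZR a / IZR b by exact: Rdiv_lt_0_compat.
have := Rcomplements.ln_le _ _ (pow_lt 2 i ltac:(lra)) h.
rewrite !ln_pow //; last lra.
move=> h'; apply: (Rmult_le_reg_l (INR j)) => //.
have -> : INR j * (INR i / INR j * ln 2) = INR i * ln 2 by field; lra.
lra.
Qed.

(** Subtracting 1/(2n) turns the decreasing sequence into an increasing one with the same limit;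
    each increment is nonnegative by the trapezoid rule. *)
Lemma euler_gamma_ge_harmonic (n : nat) :
  harmonic_sub_ln n.+1 - / (2 * INR n.+1) <= euler_gamma.
Proof.
pose u k := harmonic_sub_ln (n.+1 + k) - / (2 * INR (n.+1 + k)).
have u0 k : u 0%N <= u k.
  elim: k => [|k]; first exact: Rle_refl.
  move=> /Rle_trans; apply.
  rewrite /u addnS addSn /harmonic_sub_ln (@sum_n_Sm _ _ 1 (n + k).+1); last exact/leP.
  move: (n + k)%N => j.
  have jpos : 0 < INR j.+1 by apply: INR_gt0.
  rewrite [INR j.+2]S_INR /plus [AbelianMonoid.plus _ _]/=.
  have -> : ln (INR j.+1 + 1) = ln (INR j.+1) + ln (1 + / INR j.+1).
    rewrite -ln_mult //.
      by congr ln; field; lra.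
    by have := Rinv_0_lt_compat _ jpos; lra.
  have := @ln_le_trapezoid (/ INR j.+1) (Rlt_le _ _ (Rinv_0_lt_compat _ jpos)).
  have -> : / INR j.+1 * (2 + / INR j.+1) / (2 * (1 + / INR j.+1)) =
     / (2 * INR j.+1) + / (INR j.+1 + 1) - / (2 * (INR j.+1 + 1)).
    by field; lra.
  move: (sum_n_m _ _ _) (INR j.+1) => s x; rewrite /AbelianMonoid.sort /= in s *; lra.
have lim_u : is_lim_seq u euler_gamma.
  have -> : Rbar.Finite euler_gamma = Rbar.Finite (euler_gamma - 0) by rewrite Rminus_0_r.
  apply: is_lim_seq_minus'.
    have := is_lim_euler_gamma => /(is_lim_seq_incr_n _ n.+1).
    by apply: is_lim_seq_ext => k; rewrite /plus addnC.
  have inv_lim : is_lim_seq (fun k => / INR k) 0.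
    by apply: (is_lim_seq_inv INR p_infty) => //; exact: is_lim_seq_INR.
  have := @is_lim_seq_scal_l _ (/ 2) _ inv_lim.
  rewrite (_ : Rbar_mult _ _ = Rbar.Finite 0); last by congr Rbar.Finite; lra.
  move=> /(is_lim_seq_incr_n _ n.+1); apply: is_lim_seq_ext => k.
  by rewrite Rinv_mult /plus addnC.
have := is_lim_seq_le _ _ _ _ u0 (is_lim_seq_const _) lim_u.
by rewrite /u addn0.
Qed.

Lemma exp_euler_gamma_gt : 178 / 100 < exp euler_gamma.
Proof.
have g : 5768 / 10000 < euler_gamma.
  (* Sixteen terms are precise enough, and ln 16 = 4 ln 2 needs only the bound on ln 2. *)
  have := @euler_gamma_ge_harmonic 15.
  rewrite /harmonic_sub_ln.
  do !(rewrite sum_n_Sm; last exact/leP).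
  rewrite sum_n_m_zero; last exact/leP.
  rewrite /plus /zero /=.
  have -> : 1 + 1 + 1 + 1 + 1 + 1 + 1 + 1 + 1 + 1 + 1 + 1 + 1 + 1 + 1 + 1 = 2 ^ 4 by lra.
  rewrite ln_pow; last lra.
  by have := ln2_upper; rewrite /=; lra.
apply: Rlt_trans (exp_increasing _ _ g).
by have := @exp_ge_taylor (5768 / 10000) 6 ltac:(lra); rewrite /=; lra.
Qed.

(** * Sums over primes and Chebyshev's bound *)

Lemma Rplus_associative : associative Rplus.
Proof. by move=> a b c; rewrite Rplus_assoc. Qed.

HB.instance Definition _ :=
  Monoid.isComLaw.Build R 0 Rplus Rplus_associative Rplus_comm Rplus_0_l.

Definition rsum (s : seq nat) (f : nat -> R) : R := \big[Rplus/0]_(p <- s) f p.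

Lemma rsum_nil f : rsum [::] f = 0.
Proof. exact: big_nil. Qed.

Lemma rsum_cons p s f : rsum (p :: s) f = f p + rsum s f.
Proof. exact: big_cons. Qed.

Lemma rsum_cat s t f : rsum (s ++ t) f = rsum s f + rsum t f.
Proof. exact: big_cat. Qed.

Lemma rsum_perm s t f : perm_eq s t -> rsum s f = rsum t f.
Proof. exact: perm_big. Qed.

Lemma rsum_split (a : pred nat) s f :
  rsum s f = rsum [seq p <- s | a p] f + rsum [seq p <- s | ~~ a p] f.
Proof. by rewrite -rsum_cat; apply: rsum_perm; rewrite perm_sym perm_filterC. Qed.

Lemma rsum_le s f g : {in s, forall p, f p <= g p} -> rsum s f <= rsum s g.
Proof.
elim: s => [|p s IHs] fg; first by rewrite !rsum_nil; exact: Rle_refl.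
rewrite !rsum_cons; apply: Rplus_le_compat; first by apply: fg; rewrite mem_head.
by apply: IHs => q qs; apply: fg; rewrite inE qs orbT.
Qed.

Lemma rsum_eq s f g : {in s, forall p, f p = g p} -> rsum s f = rsum s g.
Proof. by move=> fg; apply: eq_big_seq. Qed.

Lemma rsum0 s : rsum s (fun=> 0) = 0.
Proof. exact: big1_eq. Qed.

Lemma rsum_const s c : rsum s (fun=> c) = INR (size s) * c.
Proof.
elim: s => [|p s IHs]; first by rewrite rsum_nil /=; lra.
rewrite rsum_cons IHs [size (_ :: _)]/= S_INR; lra.
Qed.

Lemma rsum_ge0 s f : {in s, forall p, 0 <= f p} -> 0 <= rsum s f.
Proof. by move=> f0; rewrite -(rsum0 s); exact: rsum_le. Qed.

Lemma rsum_le0 s f : {in s, forall p, f p <= 0} -> rsum s f <= 0.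
Proof. by move=> f0; rewrite -(rsum0 s); exact: rsum_le. Qed.

Lemma rsumD s f g : rsum s (fun p => f p + g p) = rsum s f + rsum s g.
Proof. exact: big_split. Qed.

Lemma rsumZ c s f : rsum s (fun p => c * f p) = c * rsum s f.
Proof.
by elim: s => [|p s IHs]; rewrite ?rsum_nil ?rsum_cons ?IHs; lra.
Qed.

Definition odd_primes (y : nat) : seq nat := [seq p <- index_iota 3 y.+1 | prime p].

Definition psum (f : nat -> R) (y : nat) : R := rsum (odd_primes y) f.

Lemma mem_odd_primes y p : (p \in odd_primes y) = [&& prime p, 2 < p & p <= y]%N.
Proof. by rewrite mem_filter mem_index_iota ltnS. Qed.

Lemma odd_primes_uniq y : uniq (odd_primes y).
Proof. by rewrite filter_uniq ?iota_uniq. Qed.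

Lemma odd_primesS y :
  odd_primes y.+1 = odd_primes y ++ (if prime y.+1 && (1 < y)%N then [:: y.+1] else [::]).
Proof.
rewrite /odd_primes /index_iota; case: (ltnP 1 y) => y1.
  rewrite (_ : (y.+2 - 3 = y.+1 - 3 + 1)%N); last by lia.
  by rewrite iotaD filter_cat subnKC //= andbT; case: (prime _).
by rewrite andbF; case: y y1 => [|[|]].
Qed.

Lemma psumS f y : psum f y.+1 = psum f y + (if prime y.+1 && (1 < y)%N then f y.+1 else 0).
Proof.
rewrite /psum odd_primesS rsum_cat; congr (_ + _).
by case: ifP => _; rewrite ?rsum_cons rsum_nil // Rplus_0_r.
Qed.

Lemma psum_add f y z : (y <= z)%N ->
  psum f z = psum f y + rsum [seq p <- odd_primes z | (y < p)%N] f.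
Proof.
move=> yz; rewrite /psum (rsum_split (fun p => p <= y)%N); congr (_ + _).
  apply/rsum_perm/uniq_perm; rewrite ?filter_uniq ?iota_uniq // => p.
  by rewrite mem_filter !mem_odd_primes; case: (prime p) => //=; lia.
by apply: (congr1 (fun s => rsum s f)); apply: eq_filter => p; rewrite ltnNge.
Qed.

(** Discarding the primes of A above y and adding the missing ones up to y can only increase the
    sum. It is meant for functions shifted by their value at y, which then change sign there. *)
Lemma rsum_exchange (A : seq nat) (y : nat) (f : nat -> R) :
  uniq A -> {in A, forall p, prime p && (2 < p)%N} ->
  (forall p, (2 < p <= y)%N -> 0 <= f p) -> (forall p, (y < p)%N -> f p <= 0) ->
  rsum A f <= psum f y.
Proof.
move=> uA oA f_ge0 f_le0; rewrite (rsum_split (fun p => p <= y)%N A).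
rewrite /psum (rsum_split (mem A) (odd_primes y)).
have -> : rsum [seq p <- A | (p <= y)%N] f = rsum [seq p <- odd_primes y | p \in A] f.
  apply/rsum_perm/uniq_perm; rewrite ?filter_uniq ?iota_uniq // => p.
  rewrite !mem_filter mem_index_iota ltnS.
  case pA: (p \in A); rewrite ?andbF //= !andbT.
  by have /andP[-> ->] := oA p pA.
apply: Rplus_le_compat_l; apply: (Rle_trans _ 0).
  by apply: rsum_le0 => p; rewrite mem_filter -ltnNge => /andP[/f_le0].
apply: rsum_ge0 => p; rewrite mem_filter mem_odd_primes => /andP[_ /and3P[_ *]].
by apply: f_ge0; lia.
Qed.

Lemma prime_INR_gt1 p : prime p -> 1 < INR p.
Proof. by move=> /prime_gt1 /ltP /lt_INR. Qed.

Lemma ln_prime_gt0 p : prime p -> 0 < ln (INR p).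
Proof. by move=> /prime_INR_gt1 p1; rewrite -ln_1; apply: ln_increasing; lra. Qed.

(** Prime factors of x outside s are dropped. Dividing x by its full power of p leaves the
    valuations at the other primes unchanged. *)
Lemma rsum_logn_le_ln (s : seq nat) (x : nat) : (0 < x)%N -> uniq s -> all prime s ->
  rsum s (fun p => INR (logn p x) * ln (INR p)) <= ln (INR x).
Proof.
elim: s x => [|p s IHs] x x0 /=.
  rewrite rsum_nil => _ _; rewrite -ln_1.
  by apply: Rcomplements.ln_le; [lra | apply: (INR_leq (a := 1))].
move=> /andP[ps us] /andP[pp als]; rewrite rsum_cons.
have d : (p ^ logn p x %| x)%N by rewrite pfactor_dvdnn.
set v := logn p x in d *.
have q0 : (0 < x %/ p ^ v)%N 
  by rewrite divn_gt0; [exact: dvdn_leq | rewrite expn_gt0 prime_gt0].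
have {2}-> : x = (p ^ v * (x %/ p ^ v))%N by rewrite mulnC divnK.
rewrite mult_INR INR_expn ln_mult; first last.
- exact: INR_gt0.
- by apply/pow_lt/INR_gt0/prime_gt0.
rewrite ln_pow; last by apply/INR_gt0/prime_gt0.
apply: Rplus_le_compat_l; apply: Rle_trans (IHs _ q0 us als).
apply: Req_le; apply: rsum_eq => q qs.
rewrite logn_div // lognX.
have qp : prime q by apply: (allP als).
rewrite (logn_prime q pp) (negbTE (_ : q != p)) ?muln0 ?subn0 //.
by apply: contraNneq ps => <-.
Qed.

(** The two equal middle coefficients of row 2m + 1 sum to at most 2^(2m+1). *)
Lemma binomial_middle_le (m : nat) : ('C(m.*2.+1, m) <= 4 ^ m)%N.
Proof.
have h : ('C(m.*2.+1, m) + 'C(m.*2.+1, m.+1) <= 2 ^ m.*2.+1)%N.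
  have := expnDn 1 1 m.*2.+1; rewrite addn1 => ->.
  have [lt1 lt2] : (m < m.*2.+2 /\ m.+1 < m.*2.+2)%N by lia.
  rewrite (bigD1 (Ordinal lt1)) // (bigD1 (Ordinal lt2)) /=; last first.
    by rewrite -val_eqE /=; lia.
  rewrite !exp1n !muln1 addnA; exact: leq_addr.
have e : 'C(m.*2.+1, m.+1) = 'C(m.*2.+1, m).
  by rewrite -bin_sub; [congr 'C(_, _) |]; lia.
move: h; rewrite e expnS -mul2n expnM (_ : 2 ^ 2 = 4)%N //; lia.
Qed.

Lemma prime_dvd_binomial_middle (m p : nat) : prime p -> (m.+1 < p <= m.*2.+1)%N ->
  (p %| 'C(m.*2.+1, m))%N.
Proof.
move=> pp /andP[lp up].
have := @bin_fact m.*2.+1 m ltac:(lia).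
have -> : (m.*2.+1 - m = m.+1)%N by lia.
have pd k : (p %| k`!)%N = (p <= k)%N.
  apply/idP/idP => [|pk]; last by rewrite dvdn_fact // prime_gt0 //; lia.
  elim: k => [|k IHk]; first by rewrite fact0 dvdn1 => /eqP pE; rewrite pE in pp.
  rewrite factS Euclid_dvdM // => /orP[/dvdn_leq|/IHk]; [exact | by lia].
have : (p %| m.*2.+1`!)%N by rewrite pd.
move=> d e; move: d; rewrite -e Euclid_dvdM // Euclid_dvdM // !pd => /orP[//|/orP[]]; lia.
Qed.

(** The argument of Erdős: for 2m + 1, the primes in (m + 1, 2m + 1] divide a binomial coefficient
    at most 4^m, and strong induction covers those up to m + 1. Even numbers above 2 add no
    prime. *)
Lemma theta_le (n : nat) : psum (fun p => ln (INR p)) n <= INR n * (2 * ln 2).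
Proof.
have l2 := ln2_lower.
elim/ltn_ind: n => -[|n] IHn; first by rewrite /psum rsum_nil /=; lra.
have [n_le1|n_gt1] := leqP n 1.
  rewrite psumS ltnNge n_le1 andbF Rplus_0_r.
  by have := IHn n (ltnSn n); rewrite S_INR; lra.
have [n_even|n_odd] := boolP (odd n).
  rewrite psumS; have -> : prime n.+1 = false.
    by apply/negP => /even_prime[|] /=; lia.
  by have := IHn n (ltnSn n); rewrite S_INR /=; lra.
pose m := n./2.
have nE : n = m.*2 by rewrite /m; lia.
have m_pos : (0 < m)%N by lia.
rewrite (@psum_add _ m.+1); last by lia.
have [IH1 b] : psum (fun p => ln (INR p)) m.+1 <= INR m.+1 * (2 * ln 2) /\
    ln (INR 'C(m.*2.+1, m)) <= INR m * (2 * ln 2).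
  split; first by apply: IHn; lia.
  have -> : INR m * (2 * ln 2) = ln (INR (4 ^ m)).
    rewrite INR_expn ln_pow; last by apply: INR_gt0.
    by rewrite (_ : INR 4 = 2 * 2) ?ln_mult /=; lra.
  apply: Rcomplements.ln_le; first by apply: INR_gt0; rewrite bin_gt0; lia.
  exact/INR_leq/binomial_middle_le.
apply: (Rle_trans _ (INR m.+1 * (2 * ln 2) + INR m * (2 * ln 2))); last first.
  by rewrite nE !S_INR -addnn plus_INR; lra.
apply: Rplus_le_compat => //; apply: Rle_trans b.
set s := [seq p <- _ | _].
have us : uniq s by apply/filter_uniq/odd_primes_uniq.
have ps : {in s, forall p, prime p && (m.+1 < p <= m.*2.+1)%N}.
  by move=> p; rewrite mem_filter mem_odd_primes nE; case: (prime p) => //=; lia.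
apply: Rle_trans (@rsum_logn_le_ln s 'C(m.*2.+1, m) _ us _); first last.
- by apply/allP => p /ps /andP[].
- by rewrite bin_gt0; lia.
apply: rsum_le => p /ps /andP[pp /andP[lp up]].
rewrite -[X in X <= _]Rmult_1_l; apply: Rmult_le_compat_r.
  exact/Rlt_le/ln_prime_gt0.
apply: (INR_leq (a := 1)).
rewrite logn_gt0 mem_primes pp bin_gt0 /=; apply/andP; split; first by lia.
by apply: prime_dvd_binomial_middle => //; rewrite lp.
Qed.

(** The inductive step amounts to (x + 1)(ln (x + 1) - ln x) >= 1. *)
Lemma ln_fact_le (n : nat) : (0 < n)%N ->
  ln (INR n`!) <= (INR n + 1) * ln (INR n) - INR n + 1.
Proof.
case: n => // n _; elim: n => [|n IHn]; first by rewrite /= ln_1; lra.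
have n0 : 0 < INR n.+1 by apply: INR_gt0.
rewrite factS mult_INR ln_mult; try by apply: INR_gt0; rewrite ?fact_gt0.
rewrite [INR n.+2]S_INR.
have := @ln_sub_le (INR n.+1) (INR n.+1 + 1) n0 ltac:(lra).
move: IHn n0; move: (INR n.+1) => x; move: (ln (INR _`!)) => F.
move=> IHn n0.
have -> : (x - (x + 1)) / (x + 1) = - / (x + 1) by field; lra.
move=> h.
have : 1 <= (x + 1) * (ln (x + 1) - ln x).
  have {1}-> : 1 = (x + 1) * / (x + 1) by field; lra.
  by apply: Rmult_le_compat_l; lra.
lra.
Qed.

(** * Mertens' theorem *)

Lemma divn_INR_ge (n d : nat) : (0 < d)%N -> INR n / INR d - 1 <= INR (n %/ d).
Proof.
move=> d0; have dR := INR_gt0 d0.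
have := INR_leq (ltnW (ltn_ceil n d0)).
rewrite mult_INR S_INR => h.
apply: (Rmult_le_reg_r (INR d)) => //.
rewrite Rmult_minus_distr_r /Rdiv Rmult_assoc Rinv_l; lra.
Qed.

Lemma logn_fact_ge (p n K : nat) : prime p -> (K <= n)%N ->
  (\sum_(1 <= k < K.+1) n %/ p ^ k <= logn p n`!)%N.
Proof.
move=> pp Kn; rewrite logn_fact // [X in (_ <= X)%N](@big_cat_nat _ _ _ K.+1) //=.
exact: leq_addr.
Qed.

(* The contribution to [ln n`!] of the prime powers 3^2, 3^3, 3^4, 5^2, 5^3 and 7^2. *)
Definition power_excess (x : R) (p : nat) : R :=
  match p with
  | 3 => x * (13 / 81) - 3
  | 5 => x * (6 / 125) - 2
  | 7 => x * (1 / 49) - 1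
  | _ => 0
  end.

Lemma logn_fact_odd_ge (p n : nat) : prime p -> (4 <= n)%N ->
  INR n / INR p - 1 + power_excess (INR n) p <= INR (logn p n`!).
Proof.
move=> pp n4.
have dv k : INR n / INR p ^ k - 1 <= INR (n %/ p ^ k).
  by rewrite -INR_expn; apply: divn_INR_ge; rewrite expn_gt0 prime_gt0.
have v4 : (\sum_(1 <= k < 5) n %/ p ^ k <= logn p n`!)%N by apply: logn_fact_ge.
have v3 : (\sum_(1 <= k < 4) n %/ p ^ k <= logn p n`!)%N by apply: logn_fact_ge => //; lia.
have v2 : (\sum_(1 <= k < 3) n %/ p ^ k <= logn p n`!)%N by apply: logn_fact_ge => //; lia.
have v1 : (\sum_(1 <= k < 2) n %/ p ^ k <= logn p n`!)%N by apply: logn_fact_ge => //; lia.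
have gen : INR n / INR p - 1 <= INR (logn p n`!).
  move/INR_leq: v1; rewrite big_nat1; apply: Rle_trans.
  by have := dv 1%N; rewrite pow_1.
move/INR_leq: v4; move/INR_leq: v3; move/INR_leq: v2.
rewrite [index_iota 1 5]/= [index_iota 1 4]/= [index_iota 1 3]/=.
rewrite !big_cons !big_nil !plus_INR.
have := dv 1%N; have := dv 2%N; have := dv 3%N; have := dv 4%N.
move: gen; clear; move: (INR (logn _ _)) => L.
move: (INR (n %/ p ^ 1)) (INR (n %/ p ^ 2)) (INR (n %/ p ^ 3)) (INR (n %/ p ^ 4)).
move: (INR n) => x a b c d.
case: p => [|[|[|[|[|[|[|[|p]]]]]]]] /=; lra.
Qed.

(* Compares [n! <= n^(n+1) e^(1-n)] with Legendre's formula, using [theta n <= n ln 4]. The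
   constant is [2 ln 2 - 1] minus the contributions of the prime 2 and of [power_excess]. *)
Lemma psum_ln_div_le (n : nat) : 32768 <= INR n ->
  psum (fun p => ln (INR p) / INR p) n <= ln (INR n) - 5860 / 10000.
Proof.
move=> nR.
have n7 : (7 <= n)%N.
  by apply/leP/INR_le; rewrite /=; lra.
have n0 : (0 < n)%N by lia.
(* Six terms of Legendre's formula: 63/64 = 1/2 + ... + 1/64, and each floor loses at most 1. *)
have v2 : INR n * (63 / 64) - 6 <= INR (logn 2 n`!).
  have /INR_leq : (\sum_(1 <= k < 7) n %/ 2 ^ k <= logn 2 n`!)%N.
    by apply: logn_fact_ge => //; lia.
  rewrite [index_iota 1 7]/= !big_cons big_nil !plus_INR.
  have dv k : INR n / 2 ^ k - 1 <= INR (n %/ 2 ^ k).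
    by rewrite -[2]/(INR 2) -INR_expn; apply: divn_INR_ge; rewrite expn_gt0.
  have := dv 1%N; have := dv 2%N; have := dv 3%N; have := dv 4%N.
  have := dv 5%N; have := dv 6%N.
  move: (INR (n %/ 2 ^ 1)) (INR (n %/ 2 ^ 2)) (INR (n %/ 2 ^ 3)) (INR (n %/ 2 ^ 4)).
  move: (INR (n %/ 2 ^ 5)) (INR (n %/ 2 ^ 6)).
  by rewrite /= => *; lra.
have := @rsum_logn_le_ln (2%N :: odd_primes n) n`!.
move=> /(_ (fact_gt0 n)); rewrite /= odd_primes_uniq mem_odd_primes andbF /=.
have -> : all prime (odd_primes n).
  by apply/allP => p; rewrite mem_odd_primes => /andP[].
move=> /(_ isT isT); rewrite rsum_cons.
have low : psum (fun p => INR n * (ln (INR p) / INR p) + -1 * ln (INR p)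
     + power_excess (INR n) p * ln (INR p)) n <=
   psum (fun p => INR (logn p n`!) * ln (INR p)) n.
  apply: rsum_le => p; rewrite mem_odd_primes => /andP[pp _].
  have := Rmult_le_compat_r _ _ _ (Rlt_le _ _ (ln_prime_gt0 pp))
    (@logn_fact_odd_ge p n pp ltac:(lia)).
  have := prime_INR_gt1 pp => p1; rewrite /Rdiv; lra.
move: low; rewrite {1}/psum !rsumD !rsumZ -!/(psum _ _).
have -> : psum (fun p => power_excess (INR n) p * ln (INR p)) n =
  (INR n * (13 / 81) - 3) * ln 3 + (INR n * (6 / 125) - 2) * ln 5
   + (INR n * (1 / 49) - 1) * ln 7.
  rewrite (@psum_add _ 7) // (_ : rsum _ _ = 0); last first.
    rewrite -(rsum0 [seq p <- odd_primes n | (7 < p)%N]).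
    apply: rsum_eq => p; rewrite mem_filter => /andP[p7 _].
    by case: p p7 => [|[|[|[|[|[|[|[|p]]]]]]]] //= _; lra.
  rewrite /psum (_ : odd_primes 7 = [:: 3; 5; 7]%N) //.
  rewrite !rsum_cons rsum_nil /power_excess.
  have -> : INR 3 = 3 by rewrite /=; lra.
  have -> : INR 5 = 5 by rewrite /=; lra.
  have -> : INR 7 = 7 by rewrite /=; lra.
  lra.
have := theta_le n; have := ln_fact_le n0.
have l2 := ln2_lower; have l2' := ln2_upper.
(* Binary logarithms of 3, 5 and 7, rounded down to multiples of 1/64. *)
have l3 := @ln_lower 3 1 101 64 erefl erefl erefl erefl.
have l5 := @ln_lower 5 1 148 64 erefl erefl erefl erefl.
have l7 := @ln_lower 7 1 179 64 erefl erefl erefl erefl.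
have u3 : ln 3 <= 2 by have := ln_sub_le (a := 3) (b := 1) ltac:(lra) ltac:(lra); rewrite ln_1; lra.
have u5 : ln 5 <= 3.
  by have := ln_sub_le (a := 5) (b := 4) ltac:(lra) ltac:(lra);
   rewrite (_ : 4 = 2 * 2) ?ln_mult; lra.
have u7 : ln 7 <= 3.
  by have := ln_sub_le (a := 7) (b := 4) ltac:(lra) ltac:(lra);
   rewrite (_ : 4 = 2 * 2) ?ln_mult; lra.
(* Tangent to ln at 2^15, where 15 ln 2 - 1 < 10. This absorbs the lower-order terms into a small
   multiple of n. *)
have lnn : ln (INR n) <= INR n * (11 / 32768).
  have := ln_sub_le (a := INR n) (b := 2 ^ 15) ltac:(lra) ltac:(lra).
  by rewrite ln_pow; last lra; rewrite (_ : INR 15 = 15); [lra | rewrite /=; lra].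
rewrite !Rdiv_1_r in l3 l5 l7.
have {}l3 : 109 / 100 <= ln 3.
  by move: l3; rewrite !INR_IZR_INZ /=; lra.
have {}l5 : 160 / 100 <= ln 5.
  by move: l5; rewrite !INR_IZR_INZ /=; lra.
have {}l7 : 193 / 100 <= ln 7.
  by move: l7; rewrite !INR_IZR_INZ /=; lra.
rewrite -/(psum _ _) (_ : INR 2 = 2) //.
have := Rmult_le_compat_r (ln 2) _ _ ltac:(lra) v2.
move: nR lnn; clear -l2 l2' l3 l5 l7 u3 u5 u7.
move: (psum (fun p => ln (INR p) / INR p) n) (psum (fun p => ln (INR p)) n) (psum _ _).
move=> a th L.
move: (INR n) (INR (logn 2 n`!) * ln 2) (ln (INR n`!)) => x v2 F.
move=> nR lnn v2_ge F_le th_le low tot.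
have x0 : 0 <= x by lra.
have := Rmult_le_compat_l x _ _ x0 l2; have := Rmult_le_compat_l x _ _ x0 l2'.
have := Rmult_le_compat_l x _ _ x0 l3; have := Rmult_le_compat_l x _ _ x0 l5.
have := Rmult_le_compat_l x _ _ x0 l7 => m1 m2 m3 m4 m5.
by apply: (Rmult_le_reg_l x); lra.
Qed.

Lemma ln_lt_id (x : R) : 0 < x -> ln x <= x - 1.
Proof. by move=> x0; have := ln_sub_le (a := x) (b := 1) x0 ltac:(lra); rewrite ln_1; lra. Qed.

(* Abel summation of [sum 1/p] against [sum (ln p)/p = ln n + E n]: as long as [E] has
   grown by at most [C], the error terms telescope to at most [C / ln n0]. *)
Lemma psum_ln1p_le (C : R) (n0 n : nat) : (1 < n0 <= n)%N ->
  let E k := psum (fun p => ln (INR p) / INR p) k - ln (INR k) in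
  (forall k, (n0 <= k <= n)%N -> E k <= E n0 + C) ->
  psum (fun p => ln (1 + / INR p)) n - psum (fun p => ln (1 + / INR p)) n0 <=
  ln (ln (INR n)) - ln (ln (INR n0)) + (E n - E n0 - C) / ln (INR n) + C / ln (INR n0).
Proof.
move=> /andP[n0_gt1 n0n] E; rewrite -(subnKC n0n).
have lpos k : (n0 <= k)%N -> 0 < ln (INR k).
  move=> k0; rewrite -ln_1; apply: ln_increasing; first lra.
  by apply: (lt_INR 1); lia.
elim: (n - n0)%N => [|d IHd] hE.
  by rewrite addn0; have := lpos _ (leqnn n0); right; field; lra.
have {}IHd := IHd (fun k hk => hE k ltac:(lia)).
have := hE (n0 + d)%N ltac:(lia).
move: IHd; rewrite addnS; have kn : (n0 <= n0 + d)%N by lia.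
move: (n0 + d)%N kn => k kn IHd Ek.
have k0 := lpos _ kn; have k1 := lpos _ (leqW kn).
have kR : 0 < INR k by apply: INR_gt0; lia.
have kS : INR k.+1 = INR k + 1 by rewrite S_INR.
have mono : ln (INR k) <= ln (INR k.+1) by apply: Rcomplements.ln_le; lra.
have LL : (ln (INR k.+1) - ln (INR k)) / ln (INR k.+1) <= ln (ln (INR k.+1)) - ln (ln (INR k)).
  have := ln_sub_le k0 k1.
  rewrite -(Ropp_minus_distr (ln (INR k.+1)) (ln (INR k))) Ropp_div; lra.
have inv : / ln (INR k.+1) <= / ln (INR k) by apply: Rinv_le_contravar.
have b : (E k - E n0 - C) / ln (INR k) <= (E k - E n0 - C) / ln (INR k.+1).
  by apply: Rmult_le_compat_neg_l; [lra | exact: inv].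
apply: (Rle_trans _ (ln (ln (INR k.+1)) - ln (ln (INR n0)) + (E k - E n0 - C) / ln (INR k.+1)
   + C / ln (INR n0) - (ln (INR k.+1) - ln (INR k)) / ln (INR k.+1)
   + (psum (fun p => ln (1 + / INR p)) k.+1 - psum (fun p => ln (1 + / INR p)) k))).
  lra.
have -> : E k.+1 = E k + ((if prime k.+1 && (1 < k)%N then ln (INR k.+1) / INR k.+1 else 0)
    - (ln (INR k.+1) - ln (INR k))).
  by rewrite /E psumS; lra.
rewrite psumS; set t1 := if _ then _ else _; set t2 := if _ then _ else _.
suff : t1 <= t2 / ln (INR k.+1) by rewrite /Rdiv; lra.
rewrite /t1 /t2; case: ifP => _; last by rewrite /Rdiv; lra.
have -> : ln (INR k.+1) / INR k.+1 / ln (INR k.+1) = / INR k.+1 by field; lra.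
have i0 : 0 < / INR k.+1 by apply: Rinv_0_lt_compat; lra.
by have := @ln_lt_id (1 + / INR k.+1) ltac:(lra); lra.
Qed.

(** * Certified sums over the primes up to 33602 *)

Definition small_primes : seq Z := [::
  3; 5; 7; 11; 13; 17; 19; 23; 29; 31; 37; 41; 43; 47; 53; 59; 61; 67; 71; 73;
  79; 83; 89; 97; 101; 103; 107; 109; 113; 127; 131; 137; 139; 149; 151; 157;
  163; 167; 173; 179; 181]%Z.

Definition prime_test (p : Z) : bool :=
  all (fun q => (p <? q * q)%Z || ~~ (p mod q =? 0)%Z) small_primes.

Lemma small_primesE : small_primes = map Z.of_nat (odd_primes 190).
Proof. by vm_compute. Qed.

(** Here 36481 = 191^2, and 191 is the first prime beyond [small_primes], so an odd composite below
    it has a listed divisor q with q^2 <= p. The guard [p <? q * q] keeps listed primes from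
    rejecting themselves. *)
Lemma prime_testP (p : nat) : odd p -> (2 < p)%N -> (Z.of_nat p < 36481)%Z ->
  prime_test (Z.of_nat p) = prime p.
Proof.
move=> p_odd p_gt2 p_lt; rewrite /prime_test small_primesE all_map.
apply/allP/idP => [tested|pp q].
  apply: contraT => np.
  have p2 : (pdiv p ^ 2 <= p)%N by rewrite leqNgt; apply: contra np => /ltn_pdiv2_prime; apply; lia.
  have pd : prime (pdiv p) by apply: pdiv_prime; lia.
  have dv := pdiv_dvd p.
  have dodd : odd (pdiv p) by apply: dvdn_odd dv p_odd.
  have := tested (pdiv p); rewrite mem_odd_primes pd odd_prime_gt2 //=.
  have -> : (pdiv p <= 190)%N by move: p2 p_lt; rewrite expnS expn1; nia.
  move=> /(_ isT); case: Z.ltb_spec => /= hq; first by move: p2 hq; rewrite expnS expn1; nia.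
  case: Z.eqb_spec => //= h _; exfalso; apply: h.
  by move: dv => /dvdnP[k {1}->]; rewrite Nat2Z.inj_mul Z_mod_mult.
rewrite mem_odd_primes /= => /and3P[qp q2 _].
case: Z.ltb_spec => //= qq; case: Z.eqb_spec => //= /Z.mod_divide h.
have {h} [k kE] := h ltac:(lia).
move: (pp) => /primeP[_ /(_ q)].
have -> : (q %| p)%N by apply/dvdnP; exists (Z.to_nat k); nia.
by move=> /(_ isT) /orP[/eqP|/eqP]; nia.
Qed.

(* Fixed-point arithmetic at scale [2^30]. While [p] runs through the odd numbers, [l] stays
   below [ln p], and [d], [t], [a] bound the product of [1 + 1/q] from above and the sums of
   [ln q] and of [(ln q)/q] from below, over the odd primes [q < p]. The step of [l] is
   [ln ((p+2)/p) >= 2/(p+1)]. *)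
Fixpoint scan (fuel : nat) (p l d t a : Z) : Z * Z * Z * Z * Z :=
  if fuel is f.+1 then
    let l' := (l + 2 ^ 31 / (p + 1))%Z in
    if prime_test p then scan f (p + 2) l' (d + d / p + 1) (t + l) (a + l / p)
    else scan f (p + 2) l' d t a
  else (p, l, d, t, a).

Definition scan_inv (st : Z * Z * Z * Z * Z) : Prop :=
  let: (p, l, d, t, a) := st in
  exists q : nat, [/\ p = Z.of_nat q.+1, odd q.+1 /\ (2 <= q)%N,
    IZR l <= 2 ^ 30 * ln (INR q.+1),
    2 ^ 30 * exp (psum (fun p => ln (1 + / INR p)) q) <= IZR d &
    IZR t <= 2 ^ 30 * psum (fun p => ln (INR p)) q /\
    IZR a <= 2 ^ 30 * psum (fun p => ln (INR p) / INR p) q].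

Lemma IZR_div_le (a b : Z) : (0 < b)%Z -> IZR (a / b) <= IZR a / IZR b.
Proof.
move=> b0; have bR := IZR_lt _ _ b0.
apply: (Rmult_le_reg_r (IZR b)) => //.
rewrite /Rdiv Rmult_assoc Rinv_l ?Rmult_1_r; last lra.
rewrite -mult_IZR; apply: IZR_le; have := Z.mul_div_le a b b0; lia.
Qed.

Lemma IZR_div_ge (a b : Z) : (0 < b)%Z -> IZR a / IZR b <= IZR (a / b) + 1.
Proof.
move=> b0; have bR := IZR_lt _ _ b0.
apply: (Rmult_le_reg_r (IZR b)) => //.
rewrite /Rdiv Rmult_assoc Rinv_l ?Rmult_1_r; last lra.
rewrite -plus_IZR -mult_IZR; apply: IZR_le; have := Z.mul_succ_div_gt a b b0; lia.
Qed.

Lemma psum_odd_step f q : odd q.+1 -> (2 <= q)%N ->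
  psum f q.+2 = psum f q + (if prime q.+1 then f q.+1 else 0).
Proof.
move=> qodd q2; rewrite !psumS q2 andbT.
have -> : prime q.+2 = false by apply/negP => /even_prime[] /=; move: qodd => /=; lia.
by rewrite Rplus_0_r.
Qed.

Lemma scan_correct (fuel : nat) (p l d t a : Z) :
  (p + 2 * Z.of_nat fuel < 36481)%Z -> scan_inv (p, l, d, t, a) ->
  scan_inv (scan fuel p l d t a).
Proof.
elim: fuel p l d t a => [|fuel IH] p l d t a bound // inv.
have [q [pE [qodd q2] lE dE [tE aE]]] := inv.
have q0 : 0 < INR q.+1 by apply: INR_gt0.
have pR : IZR p = INR q.+1 by rewrite pE -INR_IZR_INZ.
have pS : (p + 2)%Z = Z.of_nat q.+3 by lia.
have lE' : IZR (l + 2 ^ 31 / (p + 1)) <= 2 ^ 30 * ln (INR q.+3).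
  rewrite plus_IZR.
  have := @IZR_div_le (2 ^ 31) (p + 1) ltac:(lia).
  rewrite plus_IZR pR.
  have -> : INR q.+3 = INR q.+1 + 2 by rewrite 2!S_INR; lra.
  have i0 : 0 < / (INR q.+1 + 1) by apply: Rinv_0_lt_compat; lra.
  have := @ln_ge1_midpoint (/ (INR q.+1 + 1)).
  have i1 : / (INR q.+1 + 1) < 1 by rewrite -[X in _ < X]Rinv_1; apply: Rinv_lt_contravar; lra.
  move=> /(_ ltac:(lra)).
  have -> : (1 + / (INR q.+1 + 1)) / (1 - / (INR q.+1 + 1)) = (INR q.+1 + 2) / INR q.+1.
    by field; lra.
  rewrite ln_div; [|lra|lra].
  have -> : IZR (2 ^ 31) / (INR q.+1 + 1) = 2 ^ 30 * (2 * / (INR q.+1 + 1)).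
    by rewrite (_ : IZR (2 ^ 31) = 2 ^ 30 * 2) ?/Rdiv; [ring | rewrite -(pow_IZR 2 31); ring].
  lra.
have pd : (0 < p)%Z by lia.
rewrite /= pE prime_testP //; try lia.
rewrite -pE; case pp: (prime _); apply: IH; try lia.
  exists q.+2; split => //; first by split; [rewrite /= negbK in qodd *; lia | lia].
    rewrite psum_odd_step // pp exp_plus exp_ln; last first.
      by have := Rinv_0_lt_compat _ q0; lra.
    have := @IZR_div_ge d p pd; rewrite !plus_IZR pR => h.
    have := Rmult_le_compat_r (1 + / INR q.+1) _ _ _ dE => h'.
    have {}h' := h' ltac:(have := Rinv_0_lt_compat _ q0; lra).
    rewrite /Rdiv in h; lra.
  rewrite !psum_odd_step // pp; split; first by rewrite plus_IZR; lra.
  have := @IZR_div_le l p pd; rewrite plus_IZR pR => h.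
  have := Rmult_le_compat_r (/ INR q.+1) _ _ (Rlt_le _ _ (Rinv_0_lt_compat _ q0)) lE.
  by rewrite /Rdiv in h *; lra.
exists q.+2; split => //; first by split; [rewrite /= negbK in qodd *; lia | lia].
  by rewrite psum_odd_step // pp Rplus_0_r.
by rewrite !psum_odd_step // pp !Rplus_0_r.
Qed.

(** Recording intermediate states as literals lets each segment be computed once and reused, both as
    a checkpoint and as the start of the next segment. *)
Lemma scan_trans (fuel p l d t a : Z) (st : Z * Z * Z * Z * Z) :
  scan_inv (p, l, d, t, a) -> (0 <=? fuel)%Z -> (p + 2 * fuel <? 36481)%Z ->
  scan (Z.to_nat fuel) p l d t a = st -> scan_inv st.
Proof.
move=> inv fuel0 bound <-; apply: scan_correct inv; rewrite Z2Nat.id; lia.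
Qed.

(** The second entry is 1.0983 at scale 2^30, rounded down; 1.0983 < ln 3 follows from 2^84 <=
    3^53. *)
Lemma scan_inv_2 : scan_inv (3, 1179290645, 2 ^ 30, 0, 0)%Z.
Proof.
exists 2%N; split => //; rewrite -?(pow_IZR 2 30).
- have := @ln_lower 3 1 84 53 erefl erefl erefl erefl.
  have := ln2_lower; rewrite Rdiv_1_r (_ : INR 3 = 3); last by rewrite /=; lra.
  by rewrite !INR_IZR_INZ /=; lra.
- by rewrite /psum rsum_nil exp_0; lra.
- by rewrite /psum !rsum_nil; lra.
Qed.

Lemma scan_inv_6 : scan_inv (7, 2074075498, 1717986920, 2895452202, 736329192)%Z.
Proof.
apply: (@scan_trans 2 _ _ _ _ _ _ scan_inv_2 isT isT).
by vm_compute.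
Qed.

Lemma scan_inv_8 : scan_inv (9, 2342510954, 1963413623, 4969527700, 1032625691)%Z.
Proof.
apply: (@scan_trans 1 _ _ _ _ _ _ scan_inv_6 isT isT).
by vm_compute.
Qed.

Lemma scan_inv_12 : scan_inv (13, 2736216288, 2141905771, 7526787018, 1265103810)%Z.
Proof.
apply: (@scan_trans 2 _ _ _ _ _ _ scan_inv_8 isT isT).
by vm_compute.
Qed.

Lemma scan_inv_16 : scan_inv (17, 3023825705, 2306667754, 10263003306, 1475581986)%Z.
Proof.
apply: (@scan_trans 2 _ _ _ _ _ _ scan_inv_12 isT isT).
by vm_compute.
Qed.

Lemma scan_inv_18 : scan_inv (19, 3143130352, 2442354093, 13286829011, 1653454086)%Z.
Proof.
apply: (@scan_trans 1 _ _ _ _ _ _ scan_inv_16 isT isT).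
by vm_compute.
Qed.

Lemma scan_inv_20 : scan_inv (21, 3250504534, 2570899046, 16429959363, 1818881999)%Z.
Proof.
apply: (@scan_trans 1 _ _ _ _ _ _ scan_inv_18 isT isT).
by vm_compute.
Qed.

Lemma scan_inv_24 : scan_inv (25, 3437595912, 2682677266, 19778076790, 1964452321)%Z.
Proof.
apply: (@scan_trans 2 _ _ _ _ _ _ scan_inv_20 isT isT).
by vm_compute.
Qed.

Lemma scan_inv_30 : scan_inv (31, 3668470068, 2775183379, 23374964070, 2088482916)%Z.
Proof.
apply: (@scan_trans 3 _ _ _ _ _ _ scan_inv_24 isT isT).
by vm_compute.
Qed.

Lemma scan_inv_32 : scan_inv (33, 3735578932, 2864705424, 27043434138, 2206820660)%Z.
Proof.
apply: (@scan_trans 1 _ _ _ _ _ _ scan_inv_30 isT isT).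
by vm_compute.
Qed.

Lemma scan_inv_42 : scan_inv (43, 4019722919, 3013889161, 34870419032, 2407896474)%Z.
Proof.
apply: (@scan_trans 5 _ _ _ _ _ _ scan_inv_32 isT isT).
by vm_compute.
Qed.

Lemma scan_inv_44 : scan_inv (45, 4068529365, 3083979607, 38890141951, 2501378402)%Z.
Proof.
apply: (@scan_trans 1 _ _ _ _ _ _ scan_inv_42 isT isT).
by vm_compute.
Qed.

Lemma scan_inv_72 : scan_inv (73, 4587947614, 3413831793, 65058015903, 2946255239)%Z.
Proof.
apply: (@scan_trans 14 _ _ _ _ _ _ scan_inv_44 isT isT).
by vm_compute.
Qed.

Lemma scan_inv_140 : scan_inv (141, 5294767745, 3912100805, 134648017224, 3621117868)%Z.
Proof.
apply: (@scan_trans 34 _ _ _ _ _ _ scan_inv_72 isT isT).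
by vm_compute.
Qed.

Lemma scan_inv_360 : scan_inv (361, 6304204153, 4604038732, 357728219201, 4567143874)%Z.
Proof.
apply: (@scan_trans 110 _ _ _ _ _ _ scan_inv_140 isT isT).
by vm_compute.
Qed.

Lemma scan_inv_1224 : scan_inv (1225, 7616119965, 5533456217, 1263099156066, 5844745653)%Z.
Proof.
apply: (@scan_trans 432 _ _ _ _ _ _ scan_inv_360 isT isT).
by vm_compute.
Qed.

Lemma scan_inv_5868 : scan_inv (5869, 9298396655, 6738503858, 6209977498317, 7506633431)%Z.
Proof.
apply: (@scan_trans 2322 _ _ _ _ _ _ scan_inv_1224 isT isT).
by vm_compute.
Qed.

Lemma scan_inv_32768 : scan_inv (32769, 11145009800, 8061670838, 34845341598482, 9334733715)%Z.
Proof.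
apply: (@scan_trans 13450 _ _ _ _ _ _ scan_inv_5868 isT isT).
by vm_compute.
Qed.

Lemma scan_inv_33602 : scan_inv (33603, 11171995315, 8082831777, 35816145330328, 9363985694)%Z.
Proof.
apply: (@scan_trans 417 _ _ _ _ _ _ scan_inv_32768 isT isT).
by vm_compute.
Qed.

(** * The sum of divisors *)

Lemma sum_sub_uniq (s t : seq nat) : uniq s -> {subset s <= t} ->
  (\sum_(d <- s) d <= \sum_(d <- t) d)%N.
Proof.
move=> us st; apply: (sub_le_big_seq leqnn (fun x y => leq_addr y x)) => d.
rewrite count_uniq_mem //; case: (boolP (d \in s)) => //= /st.
by rewrite -has_pred1 has_count.
Qed.

(** Divisors of p b are either prime to p, hence divisors of a, or p times a divisor of b. Taking a
    = b adds a new prime; taking a = m and b = 2^k m with p = 2 raises the power of two. *)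
Lemma sum_divisors_prime_mul_le (p a b : nat) : prime p -> (0 < a)%N -> (0 < b)%N ->
  (forall d, d %| p * b -> ~~ (p %| d) -> d %| a)%N ->
  (sum_divisors (p * b) <= sum_divisors a + p * sum_divisors b)%N.
Proof.
move=> pp a0 b0 h; have p0 := prime_gt0 pp.
rewrite /sum_divisors big_distrr /= -(big_map (muln p) predT id) -big_cat.
apply: sum_sub_uniq; first exact: divisors_uniq.
move=> d; rewrite -dvdn_divisors ?muln_gt0 ?p0 // mem_cat => d_dvd.
case: (boolP (p %| d)) => [/dvdnP[e eE]|/h]; last first.
  by move=> /(_ d_dvd) => da; rewrite -dvdn_divisors // da.
apply/orP; right; apply/mapP; exists e; last by rewrite eE mulnC.
by move: d_dvd; rewrite eE mulnC dvdn_pmul2l // dvdn_divisors.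
Qed.

Lemma sum_divisors_prod_le (s : seq nat) : all prime s ->
  (sum_divisors (\prod_(p <- s) p) <= \prod_(p <- s) p.+1)%N.
Proof.
elim: s => [|p s IHs] /= => [_|/andP[pp als]].
  by rewrite !big_nil /sum_divisors (_ : divisors 1 = [:: 1%N]) // big_seq1.
have s0 : (0 < \prod_(q <- s) q)%N.
  by rewrite big_seq prodn_cond_gt0 // => q /(allP als) /prime_gt0.
rewrite !big_cons.
apply: leq_trans (sum_divisors_prime_mul_le pp s0 s0 _) _.
  by move=> d d_dvd pd; move: d_dvd; rewrite Gauss_dvdr // coprime_sym prime_coprime.
by rewrite -mulSn leq_mul // IHs.
Qed.

(** This is sigma(2^k m) <= (2^(k+1) - 1) sigma(m), written without truncated subtraction. *)
Lemma sum_divisors_two_power_le (k m : nat) : (0 < m)%N -> odd m ->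
  (sum_divisors (2 ^ k * m) + sum_divisors m <= 2 ^ k.+1 * sum_divisors m)%N.
Proof.
move=> m0 m_odd; elim: k => [|k IHk]; first by rewrite mul1n expn1; lia.
have b0 : (0 < 2 ^ k * m)%N by rewrite muln_gt0 expn_gt0.
have : (sum_divisors (2 ^ k.+1 * m) <= sum_divisors m + 2 * sum_divisors (2 ^ k * m))%N.
  rewrite expnS -mulnA; apply: sum_divisors_prime_mul_le => // d.
  rewrite mulnA -expnS => d_dvd d2; move: d_dvd; rewrite Gauss_dvdr //.
  by rewrite coprime_sym coprimeXl // prime_coprime.
by rewrite (expnS 2 k.+1) -mulnA; move: (2 ^ k.+1 * sum_divisors m)%N IHk; lia.
Qed.

Lemma squarefree_prod_primes (m : nat) : (0 < m)%N -> squarefree m ->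
  m = (\prod_(p <- primes m) p)%N.
Proof.
move=> m0 sq; rewrite {1}(prod_prime_decomp m0) prime_decompE big_map /=.
apply: eq_big_seq => p p_in /=; move: (p_in); rewrite -logn_gt0.
have [v1|v2] := leqP (logn p m) 1.
  by move=> v0; have -> : logn p m = 1%N by lia.
have : (p ^ 2 %| m)%N by apply: dvdn_trans (dvdn_exp2l p v2) (pfactor_dvdnn p m).
by move=> /sq p1; move: p_in; rewrite p1 mem_primes.
Qed.

Lemma ln_prod (s : seq nat) : all prime s ->
  ln (INR (\prod_(p <- s) p)) = rsum s (fun p => ln (INR p)).
Proof.
elim: s => [|p s IHs] /= => [_|/andP[pp als]]; first by rewrite big_nil rsum_nil ln_1.
rewrite big_cons rsum_cons mult_INR ln_mult ?IHs //.
  exact/INR_gt0/prime_gt0.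
by apply: INR_gt0; rewrite big_seq prodn_cond_gt0 // => q /(allP als) /prime_gt0.
Qed.

Lemma ln_prodS (s : seq nat) : all prime s ->
  ln (INR (\prod_(p <- s) p.+1)) = ln (INR (\prod_(p <- s) p)) + rsum s (fun p => ln (1 + / INR p)).
Proof.
move=> als; rewrite ln_prod // -rsumD.
elim: s als => [|p s IHs] /= => [_|/andP[pp als]]; first by rewrite big_nil rsum_nil ln_1.
have p0 : 0 < INR p by exact/INR_gt0/prime_gt0.
rewrite big_cons rsum_cons mult_INR ln_mult ?IHs //.
- congr (_ + _); rewrite -ln_mult ?S_INR //; last by have := Rinv_0_lt_compat _ p0; lra.
  by congr ln; field; lra.
- by apply: INR_gt0.
- by apply: INR_gt0; rewrite prodn_gt0.
Qed.

Lemma sum_divisors_ratio_le (k m : nat) : (0 < m)%N -> odd m -> squarefree m ->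
  INR (sum_divisors (2 ^ k * m)) / INR (2 ^ k * m) <=
  (2 - / 2 ^ k) * exp (rsum (primes m) (fun p => ln (1 + / INR p))).
Proof.
move=> m0 m_odd m_sq.
have alp : all prime (primes m) by apply/allP => p; rewrite mem_primes => /andP[].
have mR := INR_gt0 m0.
have k0 : 0 < 2 ^ k by apply: pow_lt; lra.
have : INR (sum_divisors m) <= INR m * exp (rsum (primes m) (fun p => ln (1 + / INR p))).
  have {1 2}-> := squarefree_prod_primes m0 m_sq.
  apply: Rle_trans (INR_leq (sum_divisors_prod_le alp)) _.
  rewrite -[X in X <= _]exp_ln; last first.
    by apply: INR_gt0; rewrite prodn_gt0.
  rewrite ln_prodS // exp_plus -squarefree_prod_primes // exp_ln //; exact: Rle_refl.
have := INR_leq (sum_divisors_two_power_le k m0 m_odd).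
rewrite plus_INR !mult_INR !INR_expn (_ : INR 2 = 2) //=.
move: (exp _) (INR (sum_divisors m)) => X s h1 h2.
apply: (Rmult_le_reg_r (2 ^ k * INR m)); first exact: Rmult_lt_0_compat.
rewrite /Rdiv Rmult_assoc Rinv_l; last by apply: Rgt_not_eq; exact: Rmult_lt_0_compat.
have -> : (2 - / 2 ^ k) * X * (2 ^ k * INR m) = (2 * 2 ^ k - 1) * (INR m * X).
  by field; lra.
have : (2 * 2 ^ k - 1) * s <= (2 * 2 ^ k - 1) * (INR m * X).
  apply: Rmult_le_compat_l => //.
  by have := pow_R1_Rle 2 k ltac:(lra); lra.
lra.
Qed.

(** * Arbitrary sets of odd primes *)

Definition odd_prime_set (A : seq nat) : Prop :=
  uniq A /\ {in A, forall p, prime p && (2 < p)%N}.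

Lemma rsum_subconst s f c : rsum s (fun p => f p - c) = rsum s f - INR (size s) * c.
Proof.
have -> : rsum s (fun p => f p - c) = rsum s (fun p => f p + - c) by [].
by rewrite rsumD rsum_const; lra.
Qed.

Lemma ln1p_anti (p q : nat) : (0 < p <= q)%N -> ln (1 + / INR q) <= ln (1 + / INR p).
Proof.
move=> /andP[p0 pq]; have pR := INR_gt0 p0; have qR := INR_leq pq.
have q0 : 0 < / INR q by apply: Rinv_0_lt_compat; lra.
have ? : / INR q <= / INR p by apply: Rinv_le_contravar.
by apply: Rcomplements.ln_le; lra.
Qed.

Lemma ln_INR_mono (p q : nat) : (0 < p <= q)%N -> ln (INR p) <= ln (INR q).
Proof.
by move=> /andP[p0 pq]; apply: Rcomplements.ln_le; [exact: INR_gt0 | exact: INR_leq].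
Qed.

Lemma ln1p_ge0 (p : nat) : (0 < p)%N -> 0 <= ln (1 + / INR p).
Proof.
move=> /INR_gt0 /Rinv_0_lt_compat p0.
by rewrite -ln_1; apply: Rcomplements.ln_le; lra.
Qed.

(** The exchange is applied to ln (1 + 1/p) - ln (1 + 1/y); the subtracted constant acts as a
    Lagrange multiplier and produces the difference of cardinalities. *)
Lemma rsum_ln1p_le (A : seq nat) (y : nat) : (0 < y)%N -> odd_prime_set A ->
  rsum A (fun p => ln (1 + / INR p)) <= psum (fun p => ln (1 + / INR p)) y +
    (INR (size A) - INR (size (odd_primes y))) * ln (1 + / INR y).
Proof.
move=> y0 [uA oA].
have := @rsum_exchange A y (fun p => ln (1 + / INR p) - ln (1 + / INR y)) uA oA.
rewrite /psum !rsum_subconst => h.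
have := h (fun p hp => ltac:(have := @ln1p_anti p y ltac:(lia); lra))
  (fun p hp => ltac:(have := @ln1p_anti y p ltac:(lia); lra)); lra.
Qed.

Lemma rsum_ln_ge (A : seq nat) (y : nat) : (0 < y)%N -> odd_prime_set A ->
  psum (fun p => ln (INR p)) y + (INR (size A) - INR (size (odd_primes y))) * ln (INR y) <=
  rsum A (fun p => ln (INR p)).
Proof.
move=> y0 [uA oA].
have := @rsum_exchange A y (fun p => -1 * ln (INR p) - - ln (INR y)) uA oA.
rewrite /psum !rsum_subconst !rsumZ => h.
have := h (fun p hp => ltac:(have := @ln_INR_mono p y ltac:(lia); lra))
  (fun p hp => ltac:(have := @ln_INR_mono y p ltac:(lia); lra)); lra.
Qed.

Lemma rsum_ln1p_le_few (A : seq nat) (y : nat) : (0 < y)%N -> odd_prime_set A ->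
  (size A <= size (odd_primes y))%N ->
  rsum A (fun p => ln (1 + / INR p)) <= psum (fun p => ln (1 + / INR p)) y.
Proof.
move=> y0 oA /INR_leq h; have := rsum_ln1p_le y0 oA; have := ln1p_ge0 y0.
by move=> c0; have := Rmult_le_compat_r _ _ _ c0 h; lra.
Qed.

Lemma rsum_ln_ge_many (A : seq nat) (y : nat) : (0 < y)%N -> odd_prime_set A ->
  (size (odd_primes y) <= size A)%N ->
  psum (fun p => ln (INR p)) y <= rsum A (fun p => ln (INR p)).
Proof.
move=> y0 oA /INR_leq h; have := rsum_ln_ge y0 oA.
have c0 : 0 <= ln (INR y) by rewrite -ln_1; apply: (@ln_INR_mono 1).
by have := Rmult_le_compat_r _ _ _ c0 h; lra.
Qed.

(* The primes of [A] exceeding [y] that are not compensated by missing primes below [y]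
   number at most [ln (prod A) / ln y], and each contributes at most [1/y]. *)
Lemma rsum_ln1p_le_general (A : seq nat) (y : nat) : (1 < y)%N -> odd_prime_set A ->
  rsum A (fun p => ln (1 + / INR p)) <= psum (fun p => ln (1 + / INR p)) y +
    rsum A (fun p => ln (INR p)) / (INR y * ln (INR y)).
Proof.
move=> y1 oA; have y0 : (0 < y)%N by lia.
have lp s : {in s, forall p, prime p && (2 < p)%N} -> 0 <= rsum s (fun p => ln (INR p)).
  by move=> hs; apply: rsum_ge0 => p /hs /andP[/ln_prime_gt0 /Rlt_le].
have zA := lp A oA.2.
have zB : 0 <= psum (fun p => ln (INR p)) y.
  by apply: lp => p; rewrite mem_odd_primes andbA => /andP[].
have yR : 1 < INR y by apply: (lt_INR 1); lia.
have ly : 0 < ln (INR y) by rewrite -ln_1; apply: ln_increasing; lra.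
have yl : 0 < INR y * ln (INR y) by apply: Rmult_lt_0_compat; lra.
have q0 : 0 <= rsum A (fun p => ln (INR p)) / (INR y * ln (INR y)) by exact: Rdiv_le_0_compat.
have [le|gt] := leqP (size A) (size (odd_primes y)).
  by have := rsum_ln1p_le_few y0 oA le; lra.
have := rsum_ln1p_le y0 oA; have := rsum_ln_ge y0 oA.
have : 0 <= INR (size A) - INR (size (odd_primes y)) by have := INR_leq (ltnW gt); lra.
move: (INR (size A) - _) => j j0 h1 h2.
have i0 : 0 < / INR y by apply: Rinv_0_lt_compat; lra.
have := @ln_lt_id (1 + / INR y) ltac:(lra) => h3.
have h4 : j * ln (1 + / INR y) <= j * / INR y by apply: Rmult_le_compat_l; lra.
suff : j * / INR y <= rsum A (fun p => ln (INR p)) / (INR y * ln (INR y)) by lra.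
apply: (Rmult_le_reg_r (INR y * ln (INR y))) => //.
have -> : j * / INR y * (INR y * ln (INR y)) = j * ln (INR y) by field; lra.
rewrite /Rdiv Rmult_assoc Rinv_l; lra.
Qed.

Lemma scan_inv_bounds p l d t a : scan_inv (p, l, d, t, a) ->
  exists2 y : nat, p = Z.of_nat y.+1 & [/\ (1 < y)%N,
    exp (psum (fun p => ln (1 + / INR p)) y) <= IZR d / 2 ^ 30,
    IZR t / 2 ^ 30 <= psum (fun p => ln (INR p)) y &
    IZR a / 2 ^ 30 <= psum (fun p => ln (INR p) / INR p) y].
Proof.
move=> [y [-> [_ y2] _ dE [tE aE]]]; exists y => //.
have pos : 0 < 2 ^ 30 by apply: pow_lt; lra.
have cancel x : x / 2 ^ 30 * 2 ^ 30 = x by field; lra.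
by split => //; apply: (Rmult_le_reg_r (2 ^ 30)) => //; rewrite cancel; lra.
Qed.

(** A scan state carries the next candidate p, so the primes already summed are those up to p -
    1. *)
Definition count_odd_primes (p : Z) : nat := size (odd_primes (Z.to_nat (p - 1))).

Lemma exp_mono (x y : R) : x <= y -> exp x <= exp y.
Proof. by case=> [/exp_increasing /Rlt_le|->] //; exact: Rle_refl. Qed.

Lemma scan_few (A : seq nat) p l d t a : scan_inv (p, l, d, t, a) -> odd_prime_set A ->
  (size A <= count_odd_primes p)%N ->
  exp (rsum A (fun p => ln (1 + / INR p))) <= IZR d / 2 ^ 30.
Proof.
move=> /scan_inv_bounds[y -> [y1 dE _ _]] oA; rewrite /count_odd_primes.
rewrite (_ : Z.to_nat _ = y); last by lia.
move=> /(rsum_ln1p_le_few (ltnW y1) oA) /exp_mono h; exact: Rle_trans dE.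
Qed.

Lemma scan_many (A : seq nat) p l d t a : scan_inv (p, l, d, t, a) -> odd_prime_set A ->
  (count_odd_primes p <= size A)%N ->
  IZR t / 2 ^ 30 <= rsum A (fun p => ln (INR p)).
Proof.
move=> /scan_inv_bounds[y -> [y1 _ tE _]] oA; rewrite /count_odd_primes.
rewrite (_ : Z.to_nat _ = y); last by lia.
by move=> /(rsum_ln_ge_many (ltnW y1) oA); apply: Rle_trans.
Qed.

(** * Sets of at least seven odd primes *)

(** A form free of k: 2 replaces 2 - 2^-k, ln m replaces ln n, and 1.78 replaces e^gamma. *)
Definition robin_bound (A : seq nat) : Prop :=
  2 * exp (rsum A (fun p => ln (1 + / INR p))) < 178 / 100 * ln (rsum A (fun p => ln (INR p))).

Lemma ln_ln_ge (a b : Z) (i j : nat) (x : R) : IZR a / IZR b <= x ->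
  (0 <? a)%Z -> (0 <? b)%Z -> (0 < j)%N ->
  (2 ^ Z.of_nat i * b ^ Z.of_nat j <=? a ^ Z.of_nat j)%Z ->
  INR i / INR j * (693 / 1000) <= ln x.
Proof.
move=> ax a0 b0 j0 /(ln_lower (a := a) (b := b) ltac:(lia) ltac:(lia) j0) h.
have l2 := ln2_lower.
have ab : 0 < IZR a / IZR b by apply: Rdiv_lt_0_compat; apply: IZR_lt; lia.
have := Rcomplements.ln_le _ _ ab ax.
have ij : 0 <= INR i / INR j by apply: Rdiv_le_0_compat; [exact: pos_INR | exact: INR_gt0].
have := Rmult_le_compat_l _ _ _ ij l2; lra.
Qed.

(** The lower state bounds ln m from below, the upper one bounds the product from above, and i/j is
    a lower approximation of the binary logarithm of t / 2^30. What remains is integer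
    arithmetic. *)
Lemma robin_bound_scan (A : seq nat) (i j : nat) p l d t a p' l' d' t' a' :
  scan_inv (p, l, d, t, a) -> scan_inv (p', l', d', t', a') -> odd_prime_set A ->
  (count_odd_primes p <= size A)%N -> (size A <= count_odd_primes p')%N ->
  (0 <? t)%Z -> (0 < j)%N ->
  (2 ^ Z.of_nat i * (2 ^ 30) ^ Z.of_nat j <=? t ^ Z.of_nat j)%Z ->
  (2 * d' * 100000 * Z.of_nat j <? 178 * 693 * Z.of_nat i * 2 ^ 30)%Z ->
  robin_bound A.
Proof.
move=> st st' oA cA Ac t0 j0 lb cmp.
have := scan_few st' oA Ac; have := scan_many st oA cA.
rewrite (_ : 2 ^ 30 = IZR (2 ^ 30)); last exact: (pow_IZR 2 30).
rewrite /robin_bound; move=> /ln_ln_ge /(_ t0 erefl j0 lb) lnge dle.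
have jR := INR_gt0 j0.
have S0 : (0 < 2 ^ 30)%Z by [].
move: (2 ^ 30)%Z S0 cmp dle => S /IZR_lt S0 /Z.ltb_lt /IZR_lt.
rewrite !mult_IZR -!INR_IZR_INZ => h dle.
suff : 2 * (IZR d' / IZR S) < 178 / 100 * (INR i / INR j * (693 / 1000)) by lra.
move: (IZR S) (IZR d') S0 h => {dle} {}S D S0 h.
apply: (Rmult_lt_reg_r (100000 * INR j * S)).
  by apply: Rmult_lt_0_compat => //; lra.
have -> : 2 * (D / S) * (100000 * INR j * S) = 2 * D * 100000 * INR j by field; lra.
have -> : 178 / 100 * (INR i / INR j * (693 / 1000)) * (100000 * INR j * S) =
  178 * 693 * INR i * S by field; lra.
exact: h.
Qed.

Lemma robin_bound_large (A : seq nat) : odd_prime_set A ->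
  32768 <= rsum A (fun p => ln (INR p)) -> robin_bound A.
Proof.
move=> oA; rewrite /robin_bound.
have [n0 n0E [n0_gt1 dE _ aE]] := scan_inv_bounds scan_inv_32768.
have n0R : INR n0 = 32768.
  rewrite INR_IZR_INZ; congr IZR; lia.
have := fun y y1 => @rsum_ln1p_le_general A y y1 oA.
move: (rsum A (fun p => ln (1 + / INR p))) (rsum A (fun p => ln (INR p))) => X z general z_ge.
(* Cutting at the floor y of z = ln m keeps the tail z / (y ln y) below (1 + 1/32768) / ln y,
   because z < y + 1 and y >= 32768. *)
have [y [yz zy]] := nfloor_ex z ltac:(lra).
have y_ge : 32768 <= INR y.
  have : (32767 < Z.of_nat y)%Z by apply: lt_IZR; rewrite -INR_IZR_INZ; lra.
  by move=> h; rewrite INR_IZR_INZ; apply: IZR_le; lia.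
have n0y : (n0 <= y)%N by apply/leP/INR_le; lra.
have {}general := general y ltac:(lia).
set E := fun k => psum (fun p => ln (INR p) / INR p) k - ln (INR k).
have E_le k : 32768 <= INR k -> E k <= - (5860 / 10000).
  by move=> /psum_ln_div_le; rewrite /E; lra.
(* The largest growth of E from n0 that the Mertens bound permits; it also makes E y - E n0 - C
   nonpositive. *)
pose C := - (5860 / 10000) - E n0.
have abel := @psum_ln1p_le C n0 y (introT andP (conj n0_gt1 n0y)) _.
have {}abel := abel (fun k hk => ltac:(rewrite -/E /C;
  have := E_le k ltac:(have := @INR_leq n0 k ltac:(lia); lra); rewrite /E; lra)).
have l2 := ln2_lower; have l2' := ln2_upper.
have ln0 : ln (INR n0) = 15 * ln 2.
  rewrite n0R (_ : 32768 = 2 ^ 15); last by rewrite pow_IZR.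
  by rewrite ln_pow; [rewrite (_ : INR 15 = 15) //=; lra | lra].
have C_le : C <= 11182 / 10000.
  move: aE; rewrite /C /E ln0 (pow_IZR 2 30) /=; lra.
have ly : ln (INR n0) <= ln (INR y) by apply: Rcomplements.ln_le; lra.
have ly0 : 0 < ln (INR y) by lra.
have err : (E y - E n0 - C) / ln (INR y) <= 0.
  have := E_le y y_ge; rewrite /C => h.
  have i0 := Rinv_0_lt_compat _ ly0.
  by rewrite /Rdiv; nra.
have tail : z / (INR y * ln (INR y)) <= (32769 / 32768) / ln (INR n0).
  apply: (Rle_trans _ ((32769 / 32768) / ln (INR y))); last first.
    by apply: Rmult_le_compat_l; [lra | apply: Rinv_le_contravar; lra].
  apply: (Rmult_le_reg_r (INR y * ln (INR y))); first by apply: Rmult_lt_0_compat; lra.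
  have -> : z / (INR y * ln (INR y)) * (INR y * ln (INR y)) = z by field; lra.
  have -> : 32769 / 32768 / ln (INR y) * (INR y * ln (INR y)) = 32769 / 32768 * INR y by field; lra.
  lra.
(* Both error terms together are at most (19/64) ln 2, and 2^(19/64) <= 1.2285. *)
have total : X <= psum (fun p => ln (1 + / INR p)) n0 + (ln (ln (INR y)) - ln (ln (INR n0)))
   + ln (12285 / 10000).
  have := @ln_lower 12285 10000 19 64 erefl erefl erefl erefl.
  have b : C / ln (INR n0) + (32769 / 32768) / ln (INR n0) <= INR 19 / INR 64 * ln 2.
    apply: (Rmult_le_reg_r (ln (INR n0))); first lra.
    have -> : (C / ln (INR n0) + 32769 / 32768 / ln (INR n0)) * ln (INR n0) = C + 32769 / 32768.
      by field; lra.
    rewrite ln0 !INR_IZR_INZ /=; nra.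
  rewrite -/E in abel; move: abel err; rewrite /E; lra.
have := exp_mono total; rewrite /Rminus !exp_plus exp_Ropp; clear total.
rewrite !exp_ln; try lra.
move=> X_le; apply: (Rlt_le_trans _ (178 / 100 * ln (INR y))); last first.
  by apply: Rmult_le_compat_l; [lra | apply: Rcomplements.ln_le; lra].
apply: Rle_lt_trans (Rmult_le_compat_l 2 _ _ ltac:(lra) X_le) _.
have dE' : exp (psum (fun p => ln (1 + / INR p)) n0) <= 75081 / 10000.
  by move: dE; rewrite (pow_IZR 2 30) /=; lra.
have -> : 2 * (exp (psum (fun p => ln (1 + / INR p)) n0) * (ln (INR y) / ln (INR n0)) *
  (12285 / 10000)) = ln (INR y) * (2 * (12285 / 10000) *
   exp (psum (fun p => ln (1 + / INR p)) n0) / ln (INR n0)) by field; lra.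
rewrite Rmult_comm; apply: Rmult_lt_compat_r => //.
apply: (Rmult_lt_reg_r (ln (INR n0))); first lra.
rewrite /Rdiv Rmult_assoc Rinv_l; lra.
Qed.

Lemma robin_bound_ge7 (A : seq nat) : odd_prime_set A -> (7 <= size A)%N -> robin_bound A.
Proof.
move=> oA A7.
(* The margin is thinnest here, so seven primes get the same state at both ends; the later ranges
   widen as the margin grows. *)
have [h7|h8] := leqP (size A) 7.
  by apply: (@robin_bound_scan _ 35 9 _ _ _ _ _ _ _ _ _ _ scan_inv_20 scan_inv_20) => //;
    vm_compute.
have [h9|h10] := leqP (size A) 9.
  by apply: (@robin_bound_scan _ 21 5 _ _ _ _ _ _ _ _ _ _ scan_inv_24 scan_inv_30) => //;
    vm_compute.
have [h12|h13] := leqP (size A) 12.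
  by apply: (@robin_bound_scan _ 23 5 _ _ _ _ _ _ _ _ _ _ scan_inv_32 scan_inv_42) => //;
    vm_compute.
have c44 : (count_odd_primes 45 <= size A)%N by [].
have [c72|/ltnW c72] := leqP (size A) (count_odd_primes 73).
  exact: (@robin_bound_scan _ 31 6 _ _ _ _ _ _ _ _ _ _ scan_inv_44 scan_inv_72).
have [c140|/ltnW c140] := leqP (size A) (count_odd_primes 141).
  exact: (@robin_bound_scan _ 65 11 _ _ _ _ _ _ _ _ _ _ scan_inv_72 scan_inv_140).
have [c360|/ltnW c360] := leqP (size A) (count_odd_primes 361).
  exact: (@robin_bound_scan _ 146 21 _ _ _ _ _ _ _ _ _ _ scan_inv_140 scan_inv_360).
have [c1224|/ltnW c1224] := leqP (size A) (count_odd_primes 1225).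
  exact: (@robin_bound_scan _ 67 8 _ _ _ _ _ _ _ _ _ _ scan_inv_360 scan_inv_1224).
have [c5868|/ltnW c5868] := leqP (size A) (count_odd_primes 5869).
  exact: (@robin_bound_scan _ 51 5 _ _ _ _ _ _ _ _ _ _ scan_inv_1224 scan_inv_5868).
have [c33602|/ltnW c33602] := leqP (size A) (count_odd_primes 33603).
  exact: (@robin_bound_scan _ 37 3 _ _ _ _ _ _ _ _ _ _ scan_inv_5868 scan_inv_33602).
(* The scan runs past 2^15 because the certified sum of ln p, rounded down and without the prime 2,
   is still below 32768 there; at 33602 it exceeds it. *)
apply: robin_bound_large => //; have := scan_many scan_inv_33602 oA c33602.
by apply: Rle_trans; rewrite (_ : 2 ^ 30 = IZR (2 ^ 30)); [lra | exact: (pow_IZR 2 30)].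
Qed.

(** * Reduction to sets of primes, and the case of at most six odd primes *)

Lemma odd_prime_set_primes (m : nat) : odd m -> odd_prime_set (primes m).
Proof.
move=> m_odd; split; first exact: primes_uniq.
move=> p; rewrite mem_primes => /and3P[pp _ pm]; rewrite pp odd_prime_gt2 //.
exact: dvdn_odd pm m_odd.
Qed.

Lemma ln_prod_primes (m : nat) : (0 < m)%N -> squarefree m ->
  ln (INR m) = rsum (primes m) (fun p => ln (INR p)).
Proof.
move=> m0 m_sq; rewrite {1}(squarefree_prod_primes m0 m_sq) ln_prod //.
by apply/allP => p; rewrite mem_primes => /andP[].
Qed.

(** The left side of the assumed inequality is positive, which forces ln ln n > 0 and allows the
    denominator to be cleared. *)
Lemma robin_of_ln_ln (n k m : nat) : (0 < m)%N -> odd m -> squarefree m ->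
  n = (2 ^ k * m)%N ->
  (2 - / 2 ^ k) * exp (rsum (primes m) (fun p => ln (1 + / INR p))) <
    178 / 100 * ln (ln (INR n)) ->
  INR (sum_divisors n) / (INR n * ln (ln (INR n))) < exp euler_gamma.
Proof.
move=> m0 m_odd m_sq nE lt.
have := sum_divisors_ratio_le k m0 m_odd m_sq; rewrite -nE => ratio.
have n0 : 0 < INR n by apply: INR_gt0; rewrite nE muln_gt0 expn_gt0.
have s0 : 0 < 2 - / 2 ^ k.
  have k1 : 1 <= 2 ^ k by apply: pow_R1_Rle; lra.
  have : / 2 ^ k <= / 1 by apply: Rinv_le_contravar; lra.
  by rewrite Rinv_1; lra.
have := Rmult_lt_0_compat _ _ s0 (exp_pos (rsum (primes m) (fun p => ln (1 + / INR p)))).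
move=> pos; have w0 : 0 < ln (ln (INR n)) by lra.
have -> : INR (sum_divisors n) / (INR n * ln (ln (INR n))) =
  INR (sum_divisors n) / INR n / ln (ln (INR n)) by field; lra.
apply: (Rmult_lt_reg_r (ln (ln (INR n)))) => //.
rewrite {1}/Rdiv Rmult_assoc Rinv_l ?Rmult_1_r; last lra.
have := Rmult_lt_compat_r _ _ _ w0 exp_euler_gamma_gt; lra.
Qed.

Theorem theorem5p6 (n k m : nat)
    (m_pos : (0 < m)%N) (m_odd : odd m) (m_squarefree : squarefree m)
    (n_eq : n = (2 ^ k * m)%N) (n_ge : (841 <= n)%N) :
  (INR (sum_divisors n) / (INR n * ln (ln (INR n))) < exp euler_gamma)%R.
Proof.
apply: (robin_of_ln_ln m_pos m_odd m_squarefree n_eq).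
have oA := odd_prime_set_primes m_odd.
have k0 : 0 < 2 ^ k by apply: pow_lt; lra.
have m0 := INR_gt0 m_pos.
have lnn : ln (INR n) = INR k * ln 2 + ln (INR m).
  by rewrite n_eq mult_INR INR_expn (_ : INR 2 = 2) // ln_mult // ln_pow //; lra.
have l2 := ln2_lower.
have zE := ln_prod_primes m_pos m_squarefree.
have kk : 0 <= INR k * ln 2 by apply: Rmult_le_pos; [exact: pos_INR | lra].
have ik : 0 < / 2 ^ k by apply: Rinv_0_lt_compat.
move: (exp_pos (rsum (primes m) (fun p => ln (1 + / INR p)))).
have [A7|A6] := leqP 7 (size (primes m)).
  have := robin_bound_ge7 oA A7; rewrite /robin_bound -zE.
  have m1 : 1 < INR m.
    by apply: (lt_INR 1); case: (m) A7 m_pos => [|[|?]] // _ _; lia.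
  have z0 : 0 < ln (INR m) by rewrite -ln_1; apply: ln_increasing; lra.
  have : ln (ln (INR m)) <= ln (ln (INR n)) by apply: Rcomplements.ln_le; lra.
  by nra.
(* Common shape of the remaining cases: d / 2^30 bounds the product, b/c bounds ln n, i/j bounds the
   binary logarithm of b/c, and s bounds 2 - 2^-k. *)
have close (d b c : Z) (i j : nat) (s : R) :
    exp (rsum (primes m) (fun p => ln (1 + / INR p))) <= IZR d / 2 ^ 30 ->
    IZR b / IZR c <= ln (INR n) -> 2 - / 2 ^ k <= s ->
    (0 <? b)%Z -> (0 <? c)%Z -> (0 < j)%N ->
    (2 ^ Z.of_nat i * c ^ Z.of_nat j <=? b ^ Z.of_nat j)%Z ->
    s * (IZR d / 2 ^ 30) < 178 / 100 * (IZR (Z.of_nat i) / IZR (Z.of_nat j) * (693 / 1000)) ->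
    (2 - / 2 ^ k) * exp (rsum (primes m) (fun p => ln (1 + / INR p))) <
      178 / 100 * ln (ln (INR n)).
  rewrite -!INR_IZR_INZ => dE /ln_ln_ge h sE b0 c0 j0 /(h _ _ b0 c0 j0) {}h cmp.
  have k1 : 1 <= 2 ^ k by apply: pow_R1_Rle; lra.
  have : / 2 ^ k <= / 1 by apply: Rinv_le_contravar; lra.
  rewrite Rinv_1 => ik1.
  have := Rmult_le_compat _ _ _ _ _ (Rlt_le _ _ (exp_pos _)) sE dE; lra.
move=> X0.
have S30 : 2 ^ 30 = 1073741824 by rewrite /=; lra.
have ln841 : 67 / 10 <= ln (INR n).
  have := @ln_lower 841 1 97 10 erefl erefl erefl erefl.
  have : ln 841 <= ln (INR n).
    apply: Rcomplements.ln_le; first lra.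
    by have := INR_leq n_ge; rewrite [INR 841]INR_IZR_INZ /=; lra.
  by rewrite Rdiv_1_r !INR_IZR_INZ /=; lra.
have few p l d t a st c := @scan_few (primes m) p l d t a st oA c.
have many p l d t a st c := @scan_many (primes m) p l d t a st oA c.
rewrite -zE in many.
have s_le (K : nat) : (k <= K)%N -> 2 - / 2 ^ k <= 2 - / 2 ^ K.
  move=> kK; have : / 2 ^ K <= / 2 ^ k; last lra.
  by apply: Rinv_le_contravar => //; apply: Rle_pow; [lra | apply/leP].
have k_ge (K : nat) : (K <= k)%N -> IZR (Z.of_nat K) * (693 / 1000) <= INR k * ln 2.
  by rewrite -INR_IZR_INZ => /INR_leq h; apply: Rmult_le_compat => //; [exact: pos_INR | lra | lra].
have [A2|A3] := leqP (size (primes m)) 2.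
  by apply: (close _ 67%Z 10%Z 27%N 10%N 2 (few _ _ _ _ _ scan_inv_6 A2)) => //;
    rewrite ?S30 /=; lra.
have [A3'|A4] := leqP (size (primes m)) 3.
  have dE := few _ _ _ _ _ scan_inv_8 A3'.
  have := many _ _ _ _ _ scan_inv_8 A3; rewrite S30 => tE.
  have [k2|k3] := leqP k 2.
    by apply: (close _ 67%Z 10%Z 27%N 10%N _ dE _ (s_le _ k2)) => //;
      rewrite ?S30 /=; lra.
  (* The critical case: 840 = 8 * 3 * 5 * 7 violates the inequality. For k = 3, n >= 841 gives m >=
     106, and the next odd number with exactly three prime factors is 165 = 3 * 5 * 11. *)
  have [k3'|k4] := leqP k 3.
    have m165 : (165 <= m)%N.
      have m106 : (106 <= m)%N by move: n_ge; rewrite n_eq (_ : k = 3%N) ?mulnDl; lia.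
      rewrite leqNgt; apply/negP => m_lt.
      have /allP/(_ m) : all (fun x => ~~ (odd x && (size (primes x) == 3))%N) (iota 106 59).
        by vm_compute.
      by rewrite mem_iota m106 m_lt m_odd eqn_leq A3 A3' => /(_ isT).
    have ln165 := @ln_lower 165 1 73 10 erefl erefl erefl erefl.
    have lnm : ln 165 <= ln (INR m).
      apply: Rcomplements.ln_le; first lra.
      by have := INR_leq m165; rewrite [INR 165]INR_IZR_INZ.
    rewrite Rdiv_1_r !INR_IZR_INZ /= in ln165.
    have /= kl := k_ge _ k3.
    by apply: (close _ 71%Z 10%Z 28%N 10%N _ dE _ (s_le _ k3')) => //;
      rewrite ?S30 /=; lra.
  have [k4'|k5] := leqP k 4.
    have /= kl := k_ge _ k4.
    by apply: (close _ 74%Z 10%Z 23%N 8%N _ dE _ (s_le _ k4')) => //;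
      rewrite ?S30 /=; lra.
  have /= kl := k_ge _ k5.
  by apply: (close _ 8%Z 1%Z 3%N 1%N 2 dE) => //; rewrite ?S30 /=; lra.
have [A4'|A5] := leqP (size (primes m)) 4.
  have dE := few _ _ _ _ _ scan_inv_12 A4'.
  have := many _ _ _ _ _ scan_inv_12 A4; rewrite S30 => tE.
  have [k1|k2] := leqP k 1.
    by apply: (close _ 67%Z 10%Z 27%N 10%N _ dE _ (s_le _ k1)) => //;
      rewrite ?S30 /=; lra.
  have [k2'|k3] := leqP k 2.
    have /= kl := k_ge _ k2.
    by apply: (close _ 83%Z 10%Z 3%N 1%N _ dE _ (s_le _ k2')) => //;
      rewrite ?S30 /=; lra.
  have [k3'|k4] := leqP k 3.
    have /= kl := k_ge _ k3.
    by apply: (close _ 9%Z 1%Z 31%N 10%N _ dE _ (s_le _ k3')) => //;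
      rewrite ?S30 /=; lra.
  have /= kl := k_ge _ k4.
  by apply: (close _ 97%Z 10%Z 13%N 4%N 2 dE) => //; rewrite ?S30 /=; lra.
have [A5'|A6'] := leqP (size (primes m)) 5.
  have dE := few _ _ _ _ _ scan_inv_16 A5'.
  have := many _ _ _ _ _ scan_inv_16 A5; rewrite S30 => tE.
  have [k2|k3] := leqP k 2.
    by apply: (close _ 95%Z 10%Z 16%N 5%N _ dE _ (s_le _ k2)) => //;
      rewrite ?S30 /=; lra.
  have /= kl := k_ge _ k3.
  by apply: (close _ 116%Z 10%Z 7%N 2%N 2 dE) => //; rewrite ?S30 /=; lra.
have dE := few _ _ _ _ _ scan_inv_18 A6.
have := many _ _ _ _ _ scan_inv_18 A6'; rewrite S30 => tE.
(* For k = 0 the factor 2 - 2^-k is only 1; for k >= 1 the extra ln 2 in ln n makes up for the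
   shortfall of [robin_bound] at six primes. *)
have [k0'|k1] := leqP k 0.
  by apply: (close _ 12%Z 1%Z 7%N 2%N _ dE _ (s_le _ k0')) => //;
    rewrite ?S30 /=; lra.
have /= kl := k_ge _ k1.
by apply: (close _ 1306%Z 100%Z 37%N 10%N 2 dE) => //; rewrite ?S30 /=; lra.
Qed.
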